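(* Let $\mathbb K$ be a field and let $d,n$ be positive integers such that $d>\frac{n^2+n}{4}$. Then there exists a quadratic semigroup algebra over $\mathbb K$ with $n$ generators given by $d$ relations which is finite dimensional over $\mathbb K$.
   Context: For a set $X$, $\mathbb K\langle X\rangle$ denotes the free associative (unital) algebra over the field $\mathbb K$ generated by $X$. A quadratic semigroup algebra with $n$ generators given by $d$ relations is an algebra of the form $R=\mathbb K\langle X\rangle/I$, where $X=\{x_1,\dots,x_n\}$ is an $n$-element set and $I$ is the two-sided ideal generated by relations $r_1,\dots,r_d\in\mathbb K\langle X\rangle$, each of which is either a degree 2 monomial $x_jx_k$ or a difference $x_jx_k-x_lx_m$ of two degree 2 monomials. The relations form a list; they are not required to be distinct or linearly independent. *)

(* Defs.v *)
From HB Require Import structures.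
From mathcomp Require Import all_boot all_algebra.
From mathcomp Require Import boolp.
From mathcomp.multinomials Require Import monalg.

Set Implicit Arguments.
Unset Strict Implicit.
Unset Printing Implicit Defensive.

Import GRing.Theory.
Local Open Scope ring_scope.
Local Open Scope quotient_scope.

Definition finite_dimensional (K : fieldType) (V : lmodType K) : Prop :=
  exists m : nat, inhabited (Vector.axiom m V).

Inductive ideal_generated (A : nzRingType) (S : A -> Prop) : A -> Prop :=
| ideal_gen r : S r -> ideal_generated S r
| ideal_0 : ideal_generated S 0
| ideal_sub u v :
    ideal_generated S u -> ideal_generated S v -> ideal_generated S (u - v)
| ideal_mull a u : ideal_generated S u -> ideal_generated S (a * u)
| ideal_mulr u a : ideal_generated S u -> ideal_generated S (u * a).

Lemma ideal_generated_morph (A B : nzRingType) (f : {rmorphism A -> B})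
  (S : A -> Prop) :
  (forall r, S r -> f r = 0) -> forall u, ideal_generated S u -> f u = 0.
Proof.
move=> fS u; elim=> {u} [r /fS||u v _ fu _ fv|a u _ fu|u a _ fu] //.
- exact: rmorph0.
- by rewrite rmorphB fu fv subrr.
- by rewrite rmorphM fu mulr0.
- by rewrite rmorphM fu mul0r.
Qed.

(* The quotient of an algebra by a proper two-sided ideal: ring_quotient only
   makes it a ring when the ambient ring is commutative. *)
Section QuotientAlgebra.
Variables (K : fieldType) (A : algType K) (S : A -> Prop).

Definition ideal_pred : {pred A} := fun u => `[< ideal_generated S u >].

Lemma ideal_predP u : reflect (ideal_generated S u) (u \in ideal_pred).
Proof. exact: asboolP. Qed.

Fact ideal_pred_zmod_closed : zmod_closed ideal_pred.
Proof.
split=> [|u v /ideal_predP Iu /ideal_predP Iv]; apply/ideal_predP.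
  exact: ideal_0.
exact: ideal_sub.
Qed.

HB.instance Definition _ :=
  GRing.isZmodClosed.Build A ideal_pred ideal_pred_zmod_closed.

Lemma ideal_predMl a u : u \in ideal_pred -> a * u \in ideal_pred.
Proof. by move=> /ideal_predP Iu; apply/ideal_predP/ideal_mull. Qed.

Lemma ideal_predMr a u : u \in ideal_pred -> u * a \in ideal_pred.
Proof. by move=> /ideal_predP Iu; apply/ideal_predP/ideal_mulr. Qed.

Lemma ideal_predZ c u : u \in ideal_pred -> c *: u \in ideal_pred.
Proof. by move=> Iu; rewrite -[u]mul1r scalerAl ideal_predMl. Qed.

Definition quot_algebra (proper : ~ ideal_generated S 1) : Type :=
  {ideal_quot ideal_pred}.

Variable proper : ~ ideal_generated S 1.
Local Notation Q := (quot_algebra proper).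

HB.instance Definition _ := GRing.Zmodule.on Q.
HB.instance Definition _ := EqQuotient.on Q.
HB.instance Definition _ := ZmodQuotient.on Q.

Lemma pi_eqP (u v : A) : reflect (\pi_Q u = \pi_Q v) (u - v \in ideal_pred).
Proof. by rewrite Quotient.idealrBE; apply: eqP. Qed.

Definition quot_one : Q := \pi_Q 1.
Definition quot_mul := lift_op2 Q *%R.
Definition quot_scale (c : K) := lift_op1 Q ( *:%R c).

Lemma pi_quot_mul : {morph \pi_Q : u v / u * v >-> quot_mul u v}.
Proof.
move=> u v; unlock quot_mul; set u' := repr _; set v' := repr _.
have Iu : u - u' \in ideal_pred by apply/pi_eqP; rewrite reprK.
have Iv : v - v' \in ideal_pred by apply/pi_eqP; rewrite reprK.
apply/pi_eqP; have -> : u * v - u' * v' = u * (v - v') + (u - u') * v'.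
  by rewrite mulrBr mulrBl addrA subrK.
by apply: rpredD; [exact: ideal_predMl|exact: ideal_predMr].
Qed.

Lemma pi_quot_scale c : {morph \pi_Q : u / c *: u >-> quot_scale c u}.
Proof.
move=> u; unlock quot_scale; apply/pi_eqP; rewrite -scalerBr ideal_predZ //.
by apply/pi_eqP; rewrite reprK.
Qed.

Lemma pi_quotD (u v : A) : \pi_Q (u + v) = \pi_Q u + \pi_Q v.
Proof. exact: raddfD. Qed.

Lemma quot_mulA : associative quot_mul.
Proof.
elim/quotW=> u; elim/quotW=> v; elim/quotW=> w.
by rewrite -!pi_quot_mul mulrA.
Qed.

Lemma quot_mul1 : left_id quot_one quot_mul.
Proof. by elim/quotW=> u; rewrite -pi_quot_mul mul1r. Qed.

Lemma quot_mulr1 : right_id quot_one quot_mul.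
Proof. by elim/quotW=> u; rewrite -pi_quot_mul mulr1. Qed.

Lemma quot_mulDl : left_distributive quot_mul +%R.
Proof.
elim/quotW=> u; elim/quotW=> v; elim/quotW=> w.
by rewrite -!pi_quot_mul -!pi_quotD -pi_quot_mul mulrDl.
Qed.

Lemma quot_mulDr : right_distributive quot_mul +%R.
Proof.
elim/quotW=> u; elim/quotW=> v; elim/quotW=> w.
by rewrite -!pi_quot_mul -!pi_quotD -pi_quot_mul mulrDr.
Qed.

Lemma quot_one_neq0 : quot_one != 0.
Proof.
apply/eqP => one0; apply: proper; apply/ideal_predP.
rewrite -[1]subr0; apply/pi_eqP; rewrite -[LHS]/quot_one one0.
by apply/esym; exact: raddf0.
Qed.

HB.instance Definition _ := GRing.Zmodule_isNzRing.Build Q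
  quot_mulA quot_mul1 quot_mulr1 quot_mulDl quot_mulDr quot_one_neq0.

Lemma quot_scaleA c e (x : Q) :
  quot_scale c (quot_scale e x) = quot_scale (c * e) x.
Proof. by elim/quotW: x => u; rewrite -!pi_quot_scale scalerA. Qed.

Lemma quot_scale1 : left_id 1 quot_scale.
Proof. by elim/quotW=> u; rewrite -pi_quot_scale scale1r. Qed.

Lemma quot_scaleDr : right_distributive quot_scale +%R.
Proof.
move=> c; elim/quotW=> u; elim/quotW=> v.
by rewrite -!pi_quot_scale -!pi_quotD -pi_quot_scale scalerDr.
Qed.

Lemma quot_scaleDl (x : Q) : {morph quot_scale^~ x : c e / c + e}.
Proof.
by elim/quotW: x => u c e; rewrite /= -!pi_quot_scale -pi_quotD scalerDl.
Qed.

HB.instance Definition _ := GRing.Zmodule_isLmodule.Build K Q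
  quot_scaleA quot_scale1 quot_scaleDr quot_scaleDl.

Lemma quot_scaleAl (c : K) (x y : Q) : c *: (x * y) = (c *: x) * y.
Proof.
rewrite -[LHS]/(quot_scale c (quot_mul x y)).
rewrite -[RHS]/(quot_mul (quot_scale c x) y).
elim/quotW: x => u; elim/quotW: y => v.
by rewrite -!(pi_quot_scale, pi_quot_mul) scalerAl.
Qed.

HB.instance Definition _ := GRing.Lmodule_isLalgebra.Build K Q quot_scaleAl.

Lemma quot_scaleAr (c : K) (x y : Q) : c *: (x * y) = x * (c *: y).
Proof.
rewrite -[LHS]/(quot_scale c (quot_mul x y)).
rewrite -[RHS]/(quot_mul x (quot_scale c y)).
elim/quotW: x => u; elim/quotW: y => v.
by rewrite -!(pi_quot_scale, pi_quot_mul) scalerAr.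
Qed.

HB.instance Definition _ := GRing.Lalgebra_isAlgebra.Build K Q quot_scaleAr.

End QuotientAlgebra.

(* K<X> is the monoid algebra over K of the free monoid on X. *)
Definition free_algebra (K : fieldType) (X : choiceType) :=
  {malg K[{fmonom X}]}.

HB.instance Definition _ (K : fieldType) (X : choiceType) :=
  GRing.Lalgebra.on (free_algebra K X).

Lemma free_algebra_scaleAr (K : fieldType) (X : choiceType) (c : K)
  (u v : free_algebra K X) : c *: (u * v) = u * (c *: v).
Proof.
have commC (w : free_algebra K X) : c%:MP * w = w * c%:MP.
  rewrite mul_malgC malgM_def malgZ_def fgmulgU.
  by apply: eq_bigr => k _; rewrite mulm1 mulrC.
by rewrite -!mul_malgC mulrA commC -mulrA.
Qed.

HB.instance Definition _ (K : fieldType) (X : choiceType) :=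
  GRing.Lalgebra_isAlgebra.Build K (free_algebra K X)
    (@free_algebra_scaleAr K X).

Definition gen {K : fieldType} {X : choiceType} (x : X) : free_algebra K X :=
  << fmu x >>.

Definition is_semigroup_relation (K : fieldType) (X : choiceType)
    (r : free_algebra K X) : Prop :=
  (exists j k : X, r = gen j * gen k) \/
  (exists j k l m : X, r = gen j * gen k - gen l * gen m).

(* A list of d relations; repetitions and linear dependencies are allowed. *)
Record semigroup_relations (K : fieldType) (n d : nat) := SemigroupRelations {
  relations :> d.-tuple (free_algebra K 'I_n);
  relationsP : forall r, r \in relations -> is_semigroup_relation r
}.

(* Semigroup relations have no constant term, so 1 is not in their ideal. *)
Definition coeff1 {K : fieldType} {X : choiceType} : free_algebra K X -> K :=
  @mcoeff {fmonom X} K mone.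

Lemma coeff1_zmod_morphism (K : fieldType) (X : choiceType) :
  zmod_morphism (@coeff1 K X).
Proof. exact: (raddfB (mcoeff mone : {malg K[{fmonom X}]} -> K)). Qed.

Lemma coeff1_monoid_morphism (K : fieldType) (X : choiceType) :
  monoid_morphism (@coeff1 K X).
Proof.
split; first exact: (rmorph1 (mcoeff mone : {malg K[{fmonom X}]} -> K)).
exact: (rmorphM (mcoeff mone : {malg K[{fmonom X}]} -> K)).
Qed.

HB.instance Definition _ (K : fieldType) (X : choiceType) :=
  GRing.isZmodMorphism.Build (free_algebra K X) K coeff1
    (@coeff1_zmod_morphism K X).
HB.instance Definition _ (K : fieldType) (X : choiceType) :=
  GRing.isMonoidMorphism.Build (free_algebra K X) K coeff1
    (@coeff1_monoid_morphism K X).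

Lemma coeff1_gen (K : fieldType) (X : choiceType) (x : X) :
  coeff1 (gen x : free_algebra K X) = 0.
Proof.
rewrite /coeff1 /gen mcoeffU (_ : (_ == _) = false) //.
by apply/eqP => /(congr1 val); rewrite /= fmU fm1.
Qed.

Lemma coeff1_semigroup_relation (K : fieldType) (X : choiceType)
  (r : free_algebra K X) : is_semigroup_relation r -> coeff1 r = 0.
Proof.
have genM (i j : X) : coeff1 (gen i * gen j : free_algebra K X) = 0.
  by rewrite (@coeff1_monoid_morphism K X).2 coeff1_gen mul0r.
have sub0 (u v : free_algebra K X) :
    coeff1 u = 0 -> coeff1 v = 0 -> coeff1 (u - v) = 0.
  by move=> u0 v0; rewrite (@coeff1_zmod_morphism K X) u0 v0 subrr.
case=> [[j [k ->]]|[j [k [l [m ->]]]]]; first exact: genM.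
by apply: sub0; apply: genM.
Qed.

Lemma semigroup_relations_proper (K : fieldType) (n d : nat)
  (rs : semigroup_relations K n d) :
  ~ ideal_generated (fun r => r \in relations rs) 1.
Proof.
have rs0 r : r \in relations rs -> coeff1 r = 0.
  by move=> /relationsP; apply: coeff1_semigroup_relation.
by move=> /(ideal_generated_morph rs0)/eqP; rewrite rmorph1 oner_eq0.
Qed.

Definition quadratic_semigroup_algebra (K : fieldType) (n d : nat)
    (rs : semigroup_relations K n d) : algType K :=
  quot_algebra (@semigroup_relations_proper K n d rs).

(* Main.v *)
Require Import Defs.
From HB Require Import structures.
From mathcomp Require Import all_boot all_order all_algebra.
From mathcomp Require Import boolp zify.
From mathcomp.multinomials Require Import monalg.
Import GRing.Theory Num.Theory.
Local Open Scope ring_scope.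
Local Open Scope quotient_scope.

(** The relations are homogeneous, so the algebra is finite dimensional as soon
    as all words of some length in the generators vanish.  Put m = n/2 (rounded
    down) and t = n - m, and call the generators a_1, ..., a_t, b_1, ..., b_m,
    ordered as a_1 < ... < a_t < b_m < ... < b_1; put a_0 = b_0 = 0.  No product
    of generators in increasing order occurs in a relation, so the remaining
    (n^2 + n)/2 products have to be identified essentially in pairs.  First,
    every b_p a_j is removed by
      b_p a_j = a_j a_p        if p < j,
      b_p a_j = b_j b_p        if j < p,
      b_p a_p = a_(p-1)^2,     that is, 0 if p = 1.
    This leaves b_1^2, ..., b_m^2 and the last squares of the a_i.  The b_p^2
    are identified in pairs of consecutive indices, up to b_1^2 if m is odd.
    If n is odd, then a_t^2 = a_m^2, and the unpaired b_1^2 is 0; if n is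
    even, then a_m^2 is b_1^2 or 0, according to the parity of m.
    There are (n^2 + n) %/ 4 + 1 relations in all.

    For a word u in the indices write A u and B u for the products of the a_i
    and of the b_i; from here on, letters are compared by their indices.  Every
    product can be rewritten as A u * B v ([sorted_form_mul]), and letters move
    through words of smaller ones:
      a_k A u = B u a_k,   b_p A u = B u b_p   ([a_conv], [b_conv]).

    Long words in the b_i vanish, by induction on the largest index p
    ([nil_below_b]): if b_p^2 = b_q^2, then words with five letters b_p
    separated by words in smaller letters are equal to words of the same
    length with one letter b_p ([merge_five]).  For q < p this holds since
      b_p (B u b_p B v b_p) = b_p (B u b_q b_q A v),
    where the factor in parentheses can be sorted in letters smaller than p,
    after which b_p moves into the middle.  For q > p, replace the outer letters
    of b_p B u b_p by b_q; then
      b_q B u b_p B v b_q = b_p^2 A u a_p A v = b_p (B u (b_p a_p) A v),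
    and b_p a_p = a_(p-1)^2 again leaves only smaller letters in parentheses.
    The induction starts from the unpaired b_1, if any, which is nilpotent
    ([b1_nilpotent]).

    Long words in the a_i then vanish too, by induction on the largest index k
    ([nil_below_a_step], [nil_below_a_top]): for k < t the square a_k^2 is a
    left multiple of a_(k+1), and a_(k+1) turns the word in the a_i behind it
    into a word in the b_i, which is 0 if it is long; for k = t the square
    of a_t is 0 or a product of two other letters, so all a_t but one can be
    removed, and long words in the other letters are already known to vanish. *)

(** * Words with letters of bounded index *)

Definition below (k : nat) (u : seq nat) : bool := all (fun i => i < k)%N u.

Definition word {R : nzRingType} (x : nat -> R) (u : seq nat) : R :=
  \prod_(i <- u) x i.

Definition nil_below {R : nzRingType} (x : nat -> R) (k : nat) : Prop :=
  exists N, forall u, below k u -> (N <= size u)%N -> word x u = 0.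

Lemma belowW (k l : nat) (u : seq nat) : (k <= l)%N -> below k u -> below l u.
Proof. by move=> kl; apply: sub_all => i /leq_trans; apply. Qed.

Lemma below_cat (k : nat) (u v : seq nat) :
  below k (u ++ v) = below k u && below k v.
Proof. exact: all_cat. Qed.

Lemma below_cons (k i : nat) (u : seq nat) :
  below k (i :: u) = (i < k)%N && below k u.
Proof. by []. Qed.

Lemma split_first_max (k : nat) (u : seq nat) : below k.+1 u -> k \in u ->
  exists v w, [/\ u = v ++ k :: w, below k v, below k.+1 w &
    count_mem k u = (count_mem k w).+1].
Proof.
elim: u => // i u IH /= /andP[ik bu]; rewrite inE => ku.
have [ik_eq|ik_neq] := eqVneq i k.
  by exists [::], u; rewrite ik_eq.
have ku' : k \in u by move: ku; rewrite eq_sym (negPf ik_neq).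
have [v [w [-> bv bw ->]]] := IH bu ku'.
exists (i :: v), w; split=> //=.
by rewrite bv andbT ltn_neqAle ik_neq -ltnS.
Qed.

Lemma below_notin (k : nat) (u : seq nat) :
  below k.+1 u -> k \notin u -> below k u.
Proof.
move=> /allP bu nku; apply/allP => i iu.
rewrite ltn_neqAle -ltnS bu // andbT.
by apply: contraNneq nku => <-.
Qed.

Section Words.
Variables (R : nzRingType) (x : nat -> R).

Lemma word0 : word x [::] = 1.
Proof. exact: big_nil. Qed.

Lemma word_cons (i : nat) (u : seq nat) : word x (i :: u) = x i * word x u.
Proof. exact: big_cons. Qed.

Lemma word_cat (u v : seq nat) : word x (u ++ v) = word x u * word x v.
Proof. exact: big_cat. Qed.

Lemma few_max_word0 (k N c : nat) (u : seq nat) :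
    (forall v, below k v -> (N <= size v)%N -> word x v = 0) ->
    below k.+1 u -> (count_mem k u <= c)%N -> (c.+1 * N.+1 <= size u)%N ->
  word x u = 0.
Proof.
move=> nilN; elim: c u => [|c IH] u bu cu su.
  apply: nilN; last by rewrite mul1n in su; exact: ltnW.
  by apply: below_notin bu _; rewrite -has_pred1 has_count -leqNgt.
have [ku|nku] := boolP (k \in u); last first.
  by apply: nilN; [exact: below_notin|nia].
have [v [w [uE bv bw cE]]] := split_first_max _ _ bu ku.
rewrite uE word_cat; have [sv|sv] := leqP N (size v).
  by rewrite nilN // mul0r.
rewrite word_cons (IH w) ?mulr0 //; first by rewrite cE in cu.
by move: su; rewrite uE size_cat /= [c.+2]lock mulSn -lock; lia.
Qed.

(** Only the number of largest letters has to be controlled: between two of them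
    a nonzero word can use only boundedly many smaller letters. *)
Lemma nil_below_step (k c : nat) :
    nil_below x k ->
    (forall u, below k.+1 u -> (c < count_mem k u)%N ->
       exists v, [/\ below k.+1 v, size v = size u,
         (count_mem k v < count_mem k u)%N & word x v = word x u]) ->
  nil_below x k.+1.
Proof.
move=> [N nilN] red; exists (c.+1 * N.+1)%N => u.
have [n] := ubnP (count_mem k u); elim: n u => // n IH u cn bu su.
have [cu|cu] := leqP (count_mem k u) c.
  exact: few_max_word0 nilN bu cu su.
have [v [bv sv cv <-]] := red u bu cu.
by apply: IH; rewrite ?sv //; exact: leq_trans cv _.
Qed.

End Words.

(** * Nilpotency of the two families *)

Section TwoFamilies.
Variables (R : nzRingType) (m t : nat) (a b : nat -> R).
Hypotheses (a0 : a 0 = 0) (b0 : b 0 = 0).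
Hypotheses (le_mt : (m <= t)%N) (le_tm : (t <= m.+1)%N).
Hypothesis ba_lt : forall p j, (p < j)%N -> (j <= t)%N -> (p <= m)%N ->
  b p * a j = a j * a p.
Hypothesis ba_gt : forall p j, (j < p)%N -> (p <= m)%N -> b p * a j = b j * b p.
Hypothesis ba_eq : forall p, (p < m)%N -> b p.+1 * a p.+1 = a p * a p.

Local Notation A := (word a).
Local Notation B := (word b).

(** The relation [ba_lt] is read from right to left: [a k] stays the last letter
    a of the word while it turns its successors into letters b. *)
Lemma a_conv (k : nat) (u : seq nat) : (k <= t)%N -> below k u ->
  a k * A u = B u * a k.
Proof.
move=> kt; elim: u => [|i u IH] /=; first by rewrite !word0 mulr1 mul1r.
move=> /andP[ik bu].
have im : (i <= m)%N by rewrite -ltnS (leq_trans ik (leq_trans kt le_tm)).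
by rewrite !word_cons mulrA -ba_lt // -mulrA IH // mulrA.
Qed.

Lemma b_conv (p : nat) (u : seq nat) : (p <= m)%N -> below p u ->
  b p * A u = B u * b p.
Proof.
move=> pm; elim: u => [|i u IH] /=; first by rewrite !word0 mulr1 mul1r.
by move=> /andP[ip bu]; rewrite !word_cons mulrA ba_gt // -mulrA IH // mulrA.
Qed.

(** Products sorted with the letters a in front, together with their length and
    index bounds.  Working with this set of ring elements, which is closed under
    multiplication, avoids words that mix the two families. *)
Definition sorted_form (k s n : nat) (x : R) : Prop :=
  exists u v,
    [/\ below k u, below s v, (size u + size v)%N = n & x = A u * B v].

Lemma sorted_formA (k s : nat) (u : seq nat) :
  below k u -> sorted_form k s (size u) (A u).
Proof. by move=> bu; exists u, [::]; rewrite word0 mulr1 /= addn0. Qed.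

Lemma sorted_formB (k s : nat) (u : seq nat) :
  below s u -> sorted_form k s (size u) (B u).
Proof. by move=> bu; exists [::], u; rewrite word0 mul1r. Qed.

Section Bounds.
Variables (k s : nat).
Hypotheses (kt : (k <= t.+1)%N) (sm : (s <= m.+1)%N).

Lemma sorted_form_mulA (u : seq nat) (n : nat) (x : R) :
  below k u -> sorted_form k s n x -> sorted_form k s (size u + n)%N (A u * x).
Proof.
move=> bu [u' [v [bu' bv <- ->]]]; exists (u ++ u'), v.
by rewrite below_cat bu bu' bv word_cat size_cat mulrA addnA.
Qed.

Lemma sorted_form_mulB (v : seq nat) (n : nat) (x : R) :
  below s v -> sorted_form k s n x -> sorted_form k s (n + size v)%N (x * B v).
Proof.
move=> bv [u [v' [bu bv' <- ->]]]; exists u, (v' ++ v).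
by rewrite below_cat bu bv bv' word_cat size_cat mulrA addnA.
Qed.

(** Moving [b p] to the right, either it meets a letter [a j] with [p <= j] and
    the pair becomes two letters a, or it survives and leaves letters [b j]
    with [j < p], which have to be moved in turn; hence the outer induction
    on [p]. *)
Lemma sorted_form_bA (p : nat) (u : seq nat) : (p < s)%N -> below k u ->
  sorted_form k s (size u).+1 (b p * A u).
Proof.
elim/ltn_ind: p u => p IHp; elim=> [|j u IHu] ps /=.
  by exists [::], [:: p]; rewrite /= ps word0 mulr1 mul1r /word big_seq1.
move=> /andP[jk bu]; have pm : (p <= m)%N by rewrite -ltnS (leq_trans ps).
have jt : (j <= t)%N by rewrite -ltnS (leq_trans jk).
rewrite word_cons mulrA; have [pj|jp|pj] := ltngtP p j.
- rewrite ba_lt //; exists (j :: p :: u), [::].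
  by rewrite /= jk (ltn_trans pj) //= bu addn0 !word_cons word0 mulr1 !mulrA.
- have [u' [v [bu' bv <- E]]] := IHu ps bu.
  rewrite ba_gt // -mulrA E mulrA -addSn; apply: sorted_form_mulB => //.
  exact: IHp (ltn_trans jp ps) bu'.
- (* With index 0 both letters are 0, so any word containing a_0 will do. *)
  case: j pj jk jt => [|j] pE jk jt.
    rewrite pE b0 !mul0r; exists (0 :: 0 :: u)%N, [::].
    by rewrite /= jk bu addn0 !word_cons a0 !mul0r.
  move: ps pm; rewrite pE => ps pm.
  exists (j :: j :: u), [::].
  by rewrite /= (ltnW jk) bu addn0 ba_eq // !word_cons word0 mulr1 !mulrA.
Qed.

Lemma sorted_form_BA (v u : seq nat) : below s v -> below k u ->
  sorted_form k s (size v + size u)%N (B v * A u).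
Proof.
move=> bv bu; elim: v bv => [_|p v IH /= /andP[ps bv]].
  by rewrite word0 mul1r; apply: sorted_formA.
have [u' [v' [bu' bv' uv' E]]] := IH bv.
rewrite word_cons -mulrA E mulrA /= addSn -uv' -addSn.
apply: sorted_form_mulB => //.
exact: sorted_form_bA.
Qed.

Lemma sorted_form_mul (n1 n2 : nat) (x y : R) :
    sorted_form k s n1 x -> sorted_form k s n2 y ->
  sorted_form k s (n1 + n2)%N (x * y).
Proof.
move=> [u1 [v1 [bu1 bv1 <- ->]]] [u2 [v2 [bu2 bv2 <- ->]]].
rewrite mulrA -(mulrA (A u1)) !addnA -(addnA (size u1)).
apply: sorted_form_mulB => //; apply: sorted_form_mulA => //.
exact: sorted_form_BA.
Qed.

End Bounds.

Lemma nil_sorted_form (k s : nat) : nil_below a k -> nil_below b s ->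
  exists N, forall n x, (N <= n)%N -> sorted_form k s n x -> x = 0.
Proof.
move=> [Na nilA] [Nb nilB]; exists (Na + Nb)%N => n x Nn [u [v [bu bv uv ->]]].
have [su|su] := leqP Na (size u); first by rewrite nilA // mul0r.
by rewrite nilB ?mulr0 //; lia.
Qed.

(** A word between two letters [b q] can be moved out of them, which
    exposes the square of [b q] to its relation. *)
Lemma b_sandwich (q : nat) (u : seq nat) : (q <= m)%N -> below q u ->
  b q * B u * b q = b q * b q * A u.
Proof. by move=> qm bu; rewrite -!mulrA b_conv. Qed.

(** Any product of letters smaller than [b q] that follows [b q] can be split so
    that the letters b alone surround [b q]. *)
Lemma b_pull_out (q n : nat) (x : R) : (q <= m)%N -> sorted_form q q n x ->
  exists u v, [/\ below q u, below q v, (size u + size v)%N = n &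
    b q * x = B u * b q * B v].
Proof.
move=> qm [u [v [bu bv uv ->]]]; exists u, v; split=> //.
by rewrite mulrA b_conv.
Qed.

(** The second pair of letters [b q] is replaced by [b p] squared, so that
    everything behind the first [b q] is in smaller letters. *)
Lemma merge_larger (q p : nat) (u v : seq nat) : (p < q)%N -> (q <= m)%N ->
    b q * b q = b p * b p -> below q u -> below q v ->
  exists u' v', [/\ below q u', below q v',
    (size u' + size v')%N = (size u + size v).+2%N &
    b q * B u * b q * B v * b q = B u' * b q * B v'].
Proof.
move=> pq qm qp bu bv.
have bup : below q (u ++ [:: p; p]) by rewrite below_cat bu /= pq.
have -> : b q * B u * b q * B v * b q = b q * (B (u ++ [:: p; p]) * A v).
  rewrite -(mulrA _ (b q) (B v)) -(mulrA _ (b q * B v) (b q)) b_sandwich // qp.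
  by rewrite word_cat !word_cons word0 mulr1 !mulrA.
have qt : (q <= t.+1)%N by rewrite leqW // (leq_trans qm).
have [u' [v' [bu' bv' uv' E]]] :=
  b_pull_out _ _ _ qm (sorted_form_BA _ _ qt (leqW qm) _ _ bup bv).
by exists u', v'; split=> //; rewrite uv' size_cat /=; lia.
Qed.

(** For the smaller member [p] of a pair: the outer [b q] are replaced by
    [b p] squared, and the inner [b p] becomes an [a p], which meets one of
    these [b p] and descends with it to smaller letters. *)
Lemma merge_smaller (q p : nat) (u v : seq nat) :
    (0 < p)%N -> (p < q)%N -> (q <= m)%N ->
    b q * b q = b p * b p -> below p u -> below p v ->
  exists u' v', [/\ below p u', below p v',
    (size u' + size v')%N = (size u + size v).+2 &
    b q * B u * b p * B v * b q = B u' * b p * B v'].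
Proof.
case: p => // p _ pq qm qp bu bv; have pm := leq_trans (ltnW pq) qm.
have pt : (p.+1 <= t.+1)%N by rewrite leqW // (leq_trans pm).
have bW w : below p.+1 w -> below q w by apply: belowW; exact: ltnW.
have bupv : below q (u ++ p.+1 :: v) by rewrite below_cat bW //= pq bW.
have bppv : below p.+1 (p :: p :: v) by rewrite /= ltnSn.
have -> : b q * B u * b p.+1 * B v * b q = b p.+1 * (B u * A (p :: p :: v)).
  have := b_sandwich _ _ qm bupv; rewrite !word_cat !word_cons !mulrA => ->.
  rewrite qp -(mulrA (b p.+1) (b p.+1)) b_conv // !mulrA.
  by rewrite -(mulrA _ (b p.+1) (a p.+1)) ba_eq // !mulrA.
have [u' [v' [bu' bv' uv' E]]] :=
  b_pull_out _ _ _ pm (sorted_form_BA _ _ pt (leqW pm) _ _ bu bppv).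
by exists u', v'; split=> //; rewrite uv' /= !addnS.
Qed.

(** If [q < p], then three letters [b p] merge into one, and five do by merging
    twice.  If [p < q], the two outer pairs of letters [b p] are first turned into
    letters [b q], so that [merge_smaller] applies twice, from the inside out. *)
Lemma merge_five (p q : nat) (u1 u2 u3 u4 : seq nat) :
    (0 < p)%N -> (p <= m)%N -> (q <= m)%N -> q != p ->
    b p * b p = b q * b q ->
    below p u1 -> below p u2 -> below p u3 -> below p u4 ->
  exists u v, [/\ below p u, below p v,
    (size u + size v)%N = (size u1 + size u2 + size u3 + size u4).+4 &
    b p * B u1 * b p * B u2 * b p * B u3 * b p * B u4 * b p
      = B u * b p * B v].
Proof.
move=> p0 pm qm; rewrite neq_ltn => /orP[qp|pq] E b1 b2 b3 b4.
  have [u [v [bu bv uv ->]]] := merge_larger _ _ _ _ qp pm E b1 b2.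
  have bv3 : below p (v ++ u3) by rewrite below_cat bv.
  have [u' [v' [bu' bv' uv' E']]] := merge_larger _ _ _ _ qp pm E bv3 b4.
  exists (u ++ u'), v'; split=> //; first by rewrite below_cat bu.
    by move: uv'; rewrite !size_cat; lia.
  transitivity (B u * (b p * B (v ++ u3) * b p * B u4 * b p)).
    by rewrite word_cat !mulrA.
  by rewrite E' word_cat !mulrA.
have sandwich w : below p w -> b p * B w * b p = b q * B w * b q.
  by move=> bw; rewrite !b_sandwich ?E // (belowW p q) // ltnW.
have [u [v [bu bv uv E']]] := merge_smaller _ _ _ _ p0 pq qm (esym E) b2 b3.
have bu1 : below p (u1 ++ u) by rewrite below_cat b1.
have bv4 : below p (v ++ u4) by rewrite below_cat bv.
have [u' [v' [bu' bv' uv' E'']]] :=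
  merge_smaller _ _ _ _ p0 pq qm (esym E) bu1 bv4.
exists u', v'; split=> //; first by move: uv'; rewrite !size_cat; lia.
transitivity ((b p * B u1 * b p) * B u2 * b p * B u3 * (b p * B u4 * b p)).
  by rewrite !mulrA.
rewrite -E'' !sandwich // !word_cat.
transitivity (b q * B u1 * (b q * B u2 * b p * B u3 * b q) * B u4 * b q).
  by rewrite !mulrA.
by rewrite E' !mulrA.
Qed.

Lemma nil_below_b_step (p q : nat) :
    (0 < p)%N -> (p <= m)%N -> (q <= m)%N -> q != p ->
    b p * b p = b q * b q -> nil_below b p -> nil_below b p.+1.
Proof.
move=> p0 pm qm qp E nil_p; apply: (nil_below_step _ _ _ 4) => // w bw cw.
have [|v0 [w1 [wE b0' bw1 c1]]] := split_first_max p w bw.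
  by rewrite -has_pred1 has_count; lia.
have [|v1 [w2 [w1E b1 bw2 c2]]] := split_first_max p w1 bw1.
  by rewrite -has_pred1 has_count; lia.
have [|v2 [w3 [w2E b2 bw3 c3]]] := split_first_max p w2 bw2.
  by rewrite -has_pred1 has_count; lia.
have [|v3 [w4 [w3E b3 bw4 c4]]] := split_first_max p w3 bw3.
  by rewrite -has_pred1 has_count; lia.
have [|v4 [w5 [w4E b4 bw5 c5]]] := split_first_max p w4 bw4.
  by rewrite -has_pred1 has_count; lia.
have [u [v [bu bv uv uvE]]] := merge_five _ _ _ _ _ _ p0 pm qm qp E b1 b2 b3 b4.
have bS x : below p x -> below p.+1 x by apply: belowW.
exists (v0 ++ u ++ p :: v ++ w5); split.
- by rewrite !(below_cat, below_cons) ltnSn bw5 (bS v0) // (bS u) // (bS v).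
- move: uv; rewrite wE w1E w2E w3E w4E; do ?rewrite size_cat /=.
  by clear; lia.
- have count0 x : below p x -> count_mem p x = 0%N.
    by move=> /allP bx; apply/count_memPn/negP => /bx; rewrite ltnn.
  rewrite c1 c2 c3 c4 c5 !count_cat /= count_cat eqxx.
  by rewrite (count0 v0) // (count0 u) // (count0 v) //; clear; lia.
rewrite wE w1E w2E w3E w4E !(word_cat, word_cons).
transitivity (B v0 * (B u * b p * B v) * B w5); first by rewrite !mulrA.
by rewrite -uvE !mulrA.
Qed.

Lemma nil_below_b (l : nat) :
    (l <= m)%N -> nil_below b l.+1 ->
    (forall p, (l < p <= m)%N ->
       exists q, [/\ (q <= m)%N, q != p & b p * b p = b q * b q]) ->
  nil_below b m.+1.
Proof.
move=> lm nil_l partner.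
suff nil_p d : (l + d <= m)%N -> nil_below b (l + d).+1.
  by rewrite -(subnKC lm); apply: nil_p; rewrite subnKC.
elim: d => [|d IH] ldm; first by rewrite addn0.
have [|q [qm qp E]] := partner (l + d.+1)%N; first by rewrite ldm; lia.
apply: (nil_below_b_step _ _ _ ldm qm qp E); rewrite addnS //.
by apply: IH; rewrite -ltnS -addnS ltnW.
Qed.

(** Once the letter [a k] occurs twice, its square can be formed and replaced by
    [y * a k.+1]; then [a k.+1] turns all the rest of the word into letters b. *)
Lemma nil_below_a_step (k : nat) (y : R) :
  (k < t)%N -> a k * a k = y * a k.+1 ->
  nil_below b m.+1 -> nil_below a k -> nil_below a k.+1.
Proof.
move=> kt aky [Nb nilB] [Na nilA]; exists (Na + Na + Nb).+2 => u bu su.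
have bkm : (k.+1 <= m.+1)%N by exact: leq_trans kt le_tm.
have [ku|nku] := boolP (k \in u); last first.
  by apply: nilA; [exact: below_notin|lia].
have [v1 [u1 [uE b1 bu1 _]]] := split_first_max _ _ bu ku.
rewrite uE word_cat word_cons; have [s1|s1] := leqP Na (size v1).
  by rewrite nilA // mul0r.
have su1 : (Na + Nb < size u1)%N by move: su; rewrite uE size_cat /=; lia.
have [ku1|nku1] := boolP (k \in u1); last first.
  by rewrite (nilA u1) ?mulr0 //; [exact: below_notin|lia].
have [v2 [u2 [u1E b2 bu2 _]]] := split_first_max _ _ bu1 ku1.
rewrite u1E word_cat word_cons; have [s2|s2] := leqP Na (size v2).
  by rewrite (nilA v2) // mul0r !mulr0.
have su2 : (Nb <= size u2)%N by move: su1; rewrite u1E size_cat /=; lia.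
rewrite [a k * _]mulrA a_conv // ?(ltnW kt) // -!mulrA.
rewrite (mulrA (a k)) aky -(mulrA y) a_conv // (nilB u2) ?mul0r ?mulr0 //.
exact: belowW bu2.
Qed.

(** Neighbouring letters [a t] are brought together two by two and their
    squares removed; at most one [a t] is left over. *)
Lemma fold_top (u : seq nat) :
    sorted_form t m.+1 2 (a t * a t) -> below t.+1 u ->
  sorted_form t m.+1 (size u) (A u) \/
  exists n x v, [/\ sorted_form t m.+1 n x, below t v,
    (n + size v)%N.+1 = size u & A u = x * a t * A v].
Proof.
move=> top; have [n] := ubnP (size u); elim: n u => // n IH u un bu.
have [tu|ntu] := boolP (t \in u); last first.
  by left; apply: sorted_formA; exact: below_notin.
have [v [w [uE bv bw _]]] := split_first_max _ _ bu tu.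
have [tw|ntw] := boolP (t \in w); last first.
  right; exists (size v), (A v), w; rewrite uE word_cat word_cons mulrA.
  split; [exact: sorted_formA|exact: below_notin| |by []].
  by rewrite size_cat addnS.
have [v' [w' [wE bv' bw' _]]] := split_first_max _ _ bw tw.
have svw : size u = (size v + (size v' + 2) + size w')%N.
  by rewrite uE wE !size_cat /= size_cat /=; clear; lia.
have x_sorted : sorted_form t m.+1 (size v + (size v' + 2))
    (A v * (B v' * (a t * a t))).
  apply: sorted_form_mulA => //; apply: sorted_form_mul => //.
  by apply: sorted_formB; apply: belowW bv'.
have AuE : A u = A v * (B v' * (a t * a t)) * A w'.
  rewrite uE wE word_cat word_cons word_cat word_cons (mulrA (a t)).
  by rewrite a_conv // !mulrA.
have w'n : (size w' < n)%N by move: un svw; clear; lia.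
have [w'_sorted|[k [x [v'' [xs bv'' sw' w'E]]]]] := IH w' w'n bw'.
  by left; rewrite svw AuE; apply: sorted_form_mul.
right; exists (size v + (size v' + 2) + k)%N.
exists (A v * (B v' * (a t * a t)) * x), v''.
split=> //; first exact: sorted_form_mul.
  by rewrite svw -sw'; clear; lia.
by rewrite AuE w'E !mulrA.
Qed.

Lemma nil_below_a_top : sorted_form t m.+1 2 (a t * a t) ->
  nil_below b m.+1 -> nil_below a t -> nil_below a t.+1.
Proof.
move=> top nilB nilA; have [N nilS] := nil_sorted_form _ _ nilA nilB.
have [Na nilA'] := nilA; exists (N + Na).+1 => u bu su.
have [us|[n [x [v [xs bv nv ->]]]]] := fold_top _ top bu.
  by apply: nilS us; move: su; clear; lia.
have [Nn|nN] := leqP N n; first by rewrite (nilS n x) // !mul0r.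
by rewrite (nilA' v) ?mulr0 //; move: nN nv su; clear; lia.
Qed.

Lemma nil_below_b2 (N : nat) : b 1 ^+ N = 0 -> nil_below b 2.
Proof.
move=> b1N; exists N => u bu Nu.
have {bu} [|->] : B u = 0 \/ B u = b 1 ^+ size u.
- elim: u bu {Nu} => [_|[|[|//]] u IH /= bu]; first by right; rewrite word0.
    by left; rewrite word_cons b0 mul0r.
  by rewrite word_cons exprS; case: (IH bu) => ->; [left; rewrite mulr0|right].
- by [].
by rewrite -(subnKC Nu) exprD b1N mul0r.
Qed.

(** This starts the induction on the letters b when [b 1] has no partner among
    them but shares its square with the last letter a. *)
Lemma b1_nilpotent : (0 < m)%N -> b 1 * b 1 = a m * a m -> b 1 ^+ 5 = 0.
Proof.
move=> m0 bbaa; have ba : b 1 * a 1 = 0 by rewrite ba_eq // a0 mul0r.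
have [m1|m1] := eqVneq m 1%N.
  have -> : b 1 ^+ 5 = b 1 * (b 1 * b 1) * b 1 ^+ 2.
    by rewrite !exprS expr0 !mulr1 !mulrA.
  by rewrite bbaa m1 mulrA ba !mul0r.
have bam : b 1 * a m = a m * a 1.
  by rewrite ba_lt // ltn_neqAle eq_sym m1.
transitivity (b 1 * (b 1 * b 1) * (b 1 * b 1)).
  by rewrite !exprS expr0 !mulr1 !mulrA.
transitivity (b 1 * a m * (a m * a m) * a m); first by rewrite bbaa !mulrA.
transitivity (a m * a 1 * b 1 * (b 1 * a m)).
  by rewrite [b 1 * a m in LHS]bam -bbaa !mulrA.
transitivity (b 1 * (a m * a m) * a 1 * a 1).
  by rewrite bam !mulrA -(mulrA _ (b 1) (a m)) bam !mulrA.
by rewrite -bbaa -!mulrA (mulrA (b 1) (a 1)) ba mul0r !mulr0.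
Qed.

(** The letters [b p] with [p <= l] are those whose squares have no partner among
    the squares of the other b; they have to be nilpotent for other reasons. *)
Theorem nilpotent_generators (l : nat) :
    (l <= m)%N -> nil_below b l.+1 ->
    (forall p, (l < p <= m)%N ->
       exists q, [/\ (q <= m)%N, q != p & b p * b p = b q * b q]) ->
    (forall k, (k < t)%N -> exists y, a k * a k = y * a k.+1) ->
    sorted_form t m.+1 2 (a t * a t) ->
  exists N, forall s : seq R, (N <= size s)%N ->
    (forall x, x \in s -> sorted_form t.+1 m.+1 1 x) -> \prod_(x <- s) x = 0.
Proof.
move=> lm nil_l partner up top.
have nilB := nil_below_b _ lm nil_l partner.
have nilA k : (k <= t)%N -> nil_below a k.
  elim: k => [|k IH] kt.
    by exists 1%N => -[].
  by have [y E] := up k kt; apply: nil_below_a_step E nilB (IH (ltnW kt)).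
have nilA_top := nil_below_a_top top nilB (nilA t (leqnn t)).
have [N nilS] := nil_sorted_form _ _ nilA_top nilB.
exists N => s Ns gens; apply: nilS Ns _.
elim: s gens => [_|x s IH gens].
  by rewrite big_nil; exists [::], [::]; rewrite !word0 mulr1.
rewrite big_cons -[size _]/(1 + size s)%N; apply: sorted_form_mul => //.
  by apply: gens; rewrite mem_head.
by apply: IH => y ys; apply: gens; rewrite inE ys orbT.
Qed.

End TwoFamilies.

(** * Finite dimension from nilpotency *)

Lemma col'_mul_row'1 (K : fieldType) (n : nat) (i : 'I_n.+1) (r : 'rV[K]_n.+1) :
  r 0 i = 0 -> col' i r *m row' i 1%:M = r.
Proof.
move=> ri; apply/rowP => j; rewrite mxE.
case: (unliftP i j) => [k|] -> {j}.
  rewrite (bigD1 k) //= !mxE eqxx mulr1 big1 ?addr0 // => k' k'k.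
  by rewrite !mxE (inj_eq lift_inj) (negPf k'k) mulr0.
rewrite ri big1 // => k _.
by rewrite !mxE eq_sym (negPf (neq_lift i k)) mulr0.
Qed.

Definition onto_linear (K : fieldType) (V : lmodType K) (n : nat) : Prop :=
  exists f : 'rV[K]_n -> V, linear f /\ forall v, exists r, f r = v.

(** A linear map from the smallest possible ['rV_n] onto the space is
    injective: a vector in its kernel with a nonzero coordinate i would allow
    the i-th coordinate to be omitted. *)
Lemma onto_linear_finite_dimensional (K : fieldType) (V : lmodType K)
    (n : nat) :
  onto_linear K V n -> finite_dimensional V.
Proof.
move=> ontoV.
have exP : exists n, `[< onto_linear K V n >] by exists n; apply/asboolP.
case: (ex_minnP exP) => {n ontoV exP} m /asboolP[f [flin fsurj]] min_m.
have f_inj r : f r = 0 -> r = 0.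
  move=> fr; apply/eqP/contraT => /rV0Pn[i ri].
  case: m f flin fsurj min_m r fr i ri => [|m] f flin fsurj min_m r fr i ri.
    by case: i ri.
  have /min_m : `[< onto_linear K V m >]; last by rewrite ltnn.
  apply/asboolP; exists (fun r' => f (r' *m row' i 1%:M)); split.
    by move=> c u v; rewrite mulmxDl -scalemxAl flin.
  move=> v; have [r0 <-] := fsurj v.
  exists (col' i (- (r0 0 i / r 0 i) *: r + r0)).
  rewrite col'_mul_row'1 ?flin ?fr ?scaler0 ?add0r //.
  by rewrite !mxE mulNr divfK // addNr.
have [g gK] : exists g, cancel g f.
  by have [g gP] := choice fsurj; exists g.
have fB u v : f (u - v) = f u - f v.
  have -> : u - v = -1 *: v + u by rewrite scaleN1r addrC.
  by rewrite flin scaleN1r addrC.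
have fg : cancel f g.
  move=> r; apply/eqP; rewrite -subr_eq0; apply/eqP/f_inj.
  by rewrite fB gK subrr.
exists m; constructor; exists g; last by exists f.
by move=> c u v; apply: (can_inj fg); rewrite gK flin !gK.
Qed.

Lemma finitely_spanned_finite_dimensional (K : fieldType) (V : lmodType K)
    (T : finType) (e : T -> V) :
    (forall v, exists c : T -> K, v = \sum_t c t *: e t) ->
  finite_dimensional V.
Proof.
move=> span; apply: (onto_linear_finite_dimensional _ _ #|T|).
exists (fun r => \sum_t r 0 (enum_rank t) *: e t); split=> [c u v|v].
  rewrite scaler_sumr -big_split /=; apply: eq_bigr => t _.
  by rewrite !mxE scalerDl scalerA.
have [c ->] := span v; exists (\row_i c (enum_val i)).
by apply: eq_bigr => t _; rewrite mxE enum_rankK.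
Qed.

Lemma monomial_prod (K : fieldType) (X : choiceType) (w : seq X) :
  \prod_(x <- w) gen x = << FMonom w >> :> free_algebra K X.
Proof.
elim: w => [|x w IH]; first by rewrite big_nil -fmoneE.
rewrite big_cons IH /gen.
rewrite -[LHS]/(<< fmu x >> * << FMonom w >> : {malg K[{fmonom X}]}).
by rewrite malgM_def fgmulUU mulr1 fmuE; congr (<< _ *g _ >>); apply: fmmulE.
Qed.

(** Words shorter than [N] span; they are indexed by the finite type of tuples
    over [option X], a word being padded with [None]. *)
Lemma nilpotent_finite_dimensional (K : fieldType) (X : finType)
    (A : algType K) (f : {lrmorphism free_algebra K X -> A}) (N : nat) :
    (forall y, exists u, f u = y) ->
    (forall w : seq X, (N <= size w)%N -> \prod_(x <- w) f (gen x) = 0) ->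
  finite_dimensional A.
Proof.
move=> f_surj f_nil.
pose e (t : N.-tuple (option X)) := \prod_(x <- pmap id t) f (gen x).
apply: (finitely_spanned_finite_dimensional _ _ _ e) => y.
have [u <-] := f_surj y; rewrite (monalgE u).
pose span v := exists c, v = \sum_t c t *: e t.
have span_lin c v w : span v -> span w -> span (c *: v + w).
  move=> [cv ->] [cw ->]; exists (fun t => c * cv t + cw t).
  rewrite scaler_sumr -big_split /=; apply: eq_bigr => t _.
  by rewrite scalerA scalerDl.
have span0 : span 0.
  by exists (fun=> 0); rewrite big1 // => t _; rewrite scale0r.
have span_e t : span (e t).
  exists (fun t' => (t' == t)%:R).
  rewrite (bigD1 t) //= eqxx scale1r big1 ?addr0 //.
  by move=> t' /negPf->; rewrite scale0r.
rewrite -/(span _); apply: (big_ind (fun u => span (f u))).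
- by rewrite linear0.
- move=> v w fv fw; rewrite linearD -[X in span (X + _)]scale1r.
  exact: span_lin.
case=> w _; have -> : << (u)@_(FMonom w) *g FMonom w >> =
    (u)@_(FMonom w) *: \prod_(x <- w) gen x :> free_algebra K X.
  rewrite monomial_prod; apply/malgP => k.
  by rewrite !(mcoeffZ, mcoeffU) mulr_natr.
rewrite linearZ -[X in span X]addr0; apply: span_lin => //; rewrite rmorph_prod.
have [Nw|wN] := leqP N (size w); first by rewrite f_nil.
have sz : size (map Some w ++ nseq (N - size w) None) == N.
  by rewrite size_cat size_map size_nseq subnKC // ltnW.
have padK (k : nat) : pmap id (map Some w ++ nseq k None) = w.
  by elim: (w) => /= [|x w' ->] //; elim: k.
by have := span_e (Tuple sz); rewrite /e /= padK.
Qed.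

(** * The quotient map *)

Section Quotient.
Variables (K : fieldType) (n d : nat) (rs : semigroup_relations K n d).
Local Notation Q := (quadratic_semigroup_algebra rs).
Local Notation F := (free_algebra K 'I_n).

Definition quot_map (u : F) : Q :=
  \pi_(quot_algebra (@semigroup_relations_proper K n d rs)) u.

Lemma quot_map_zmod : zmod_morphism quot_map.
Proof. exact: raddfB. Qed.

Lemma quot_map_monoid : monoid_morphism quot_map.
Proof. split=> // u v; exact: pi_quot_mul. Qed.

Lemma quot_map_scalable : scalable quot_map.
Proof. move=> c u; exact: pi_quot_scale. Qed.

HB.instance Definition _ :=
  GRing.isZmodMorphism.Build F Q quot_map quot_map_zmod.
HB.instance Definition _ :=
  GRing.isMonoidMorphism.Build F Q quot_map quot_map_monoid.
HB.instance Definition _ :=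
  GRing.isScalable.Build K F Q *:%R quot_map quot_map_scalable.

Lemma quot_map_surj (y : Q) : exists u, quot_map u = y.
Proof. by exists (repr y); apply: reprK. Qed.

Lemma quot_map_relation (r : F) : r \in relations rs -> quot_map r = 0.
Proof.
move=> rin; rewrite -[RHS](raddf0 quot_map).
apply/pi_eqP; rewrite subr0; apply/ideal_predP; exact: ideal_gen.
Qed.
End Quotient.

(** * The relations *)

Section Relations.
Variables (K : fieldType) (n : nat).
Local Notation F := (free_algebra K 'I_n).
Local Notation m := n./2.
Local Notation t := (n - n./2)%N.
(* Index of the b whose square is left unpaired; b_0 = 0 if there is none. *)
Local Notation lone := (odd n./2 : nat).

(** Taking 0 outside the range of the generators gives the conventions that
    a_0 = b_0 = 0 below. *)
Definition letter (k : nat) : F := if insub k is Some x then gen x else 0.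

Definition left_letter (i : nat) : F := if i is k.+1 then letter k else 0.

Definition right_letter (p : nat) : F :=
  if p is _.+1 then letter (n - p) else 0.

Local Notation a := left_letter.
Local Notation b := right_letter.

Definition descent_relation (p j : nat) : F :=
  b p * a j - (if (p < j)%N then a j * a p
               else if (j < p)%N then b j * b p else a p.-1 * a p.-1).

Definition square_relation (p : nat) : F := b p * b p - b p.+1 * b p.+1.

Definition top_relation : F :=
  a t * a t - (if odd n then a m * a m else b lone * b lone).

Definition nilpotency_relations : seq F :=
  [seq descent_relation p j | p <- iota 1 m, j <- iota 1 t] ++
  [seq square_relation (lone + i.*2).+1 | i <- iota 0 m./2] ++
  top_relation :: (if odd n && odd m then [:: b 1 * b 1] else [::]).

Lemma size_nilpotency_relations :
  size nilpotency_relations = ((n * n + n) %/ 4).+1.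
Proof.
rewrite !size_cat size_allpairs size_map /= !size_iota.
have := odd_double_half n; have := odd_double_half m.
by case: (odd n); case: (odd m) => /=; nia.
Qed.

Lemma is_letter (k : nat) : (k < n)%N -> exists x, letter k = gen x.
Proof.
move=> kn; exists (Ordinal kn); rewrite /letter; case: insubP => [x _ xk|].
  by congr gen; apply: val_inj.
by rewrite kn.
Qed.

Lemma is_left_letter (i : nat) : (0 < i <= n)%N -> exists x, a i = gen x.
Proof. by case: i => // i; apply: is_letter. Qed.

Lemma is_right_letter (p : nat) : (0 < p <= n)%N -> exists x, b p = gen x.
Proof. by case: p => // p pn; apply: is_letter; lia. Qed.

Lemma semigroup_relation_monomial (u v : F) :
    (exists x, u = gen x) -> (exists x, v = gen x) ->
  is_semigroup_relation (u * v).
Proof. by move=> [x ->] [y ->]; left; exists x, y. Qed.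

Lemma semigroup_relation_sub (u v u' v' : F) :
    (exists x, u = gen x) -> (exists x, v = gen x) ->
    (exists x, u' = gen x) -> (exists x, v' = gen x) ->
  is_semigroup_relation (u * v - u' * v').
Proof.
by move=> [x ->] [y ->] [x' ->] [y' ->]; right; exists x, y, x', y'.
Qed.

Hypothesis n_gt0 : (0 < n)%N.

Lemma nilpotency_relationsP (r : F) :
  r \in nilpotency_relations -> is_semigroup_relation r.
Proof.
rewrite !mem_cat => /orP[/allpairsP[[p j] /= [pm jt ->]]|].
  move: pm jt; rewrite !mem_iota => pm jt; rewrite /descent_relation.
  have bp : exists x, b p = gen x by apply: is_right_letter; lia.
  have aj : exists x, a j = gen x by apply: is_left_letter; lia.
  case: ltngtP => [pj|jp|_].
  - by apply: semigroup_relation_sub => //; apply: is_left_letter; lia.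
  - by apply: semigroup_relation_sub => //; apply: is_right_letter; lia.
  case: p pm bp => [//|[|p]] pm bp.
    by rewrite /= mul0r subr0; apply: semigroup_relation_monomial.
  by apply: semigroup_relation_sub => //; apply: is_left_letter; lia.
move=> /orP[/mapP[i]|].
  rewrite mem_iota => im ->.
  by apply: semigroup_relation_sub; apply: is_right_letter; lia.
rewrite inE => /orP[/eqP->|].
  rewrite /top_relation; have at_gen : exists x, a t = gen x.
    by apply: is_left_letter; lia.
  case: ifP => n_odd.
    have [m0|m_gt0] := posnP m; last first.
      by apply: semigroup_relation_sub => //; apply: is_left_letter; lia.
    rewrite [in X in _ - X]m0 /= mul0r subr0.
    exact: semigroup_relation_monomial.
  case m_odd: (odd m).
    by apply: semigroup_relation_sub => //; apply: is_right_letter; lia.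
  by rewrite /= mul0r subr0; apply: semigroup_relation_monomial.
case: ifP => // /andP[n_odd m_odd]; rewrite inE => /eqP->.
by apply: semigroup_relation_monomial; apply: is_right_letter; lia.
Qed.

(** Repetitions are allowed, so a list that is too short is completed with any
    relation. *)
Lemma nilpotency_relations_of_size (d : nat) : (n * n + n < 4 * d)%N ->
  exists rs : semigroup_relations K n d,
    {subset nilpotency_relations <= relations rs}.
Proof.
move=> nd; pose x0 := Ordinal n_gt0.
pose s := nilpotency_relations ++
  nseq (d - size nilpotency_relations) (gen x0 * gen x0).
have s_size : size s == d.
  rewrite size_cat size_nseq subnKC // size_nilpotency_relations.
  by rewrite ltn_divLR // mulnC.
have sP r : r \in Tuple s_size -> is_semigroup_relation r.
  rewrite mem_cat => /orP[|/nseqP[-> _]]; first exact: nilpotency_relationsP.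
  by left; exists x0, x0.
exists (SemigroupRelations sP) => r.
by move=> rin; rewrite /= [r \in _]mem_cat rin.
Qed.

Section Nilpotency.
Variables (Q : algType K) (f : {lrmorphism F -> Q}).
Hypothesis f0 : forall r, r \in nilpotency_relations -> f r = 0.

Lemma map_descent (p j : nat) : (0 < p <= m)%N -> (0 < j <= t)%N ->
  f (b p) * f (a j) =
  f (if (p < j)%N then a j * a p
     else if (j < p)%N then b j * b p else a p.-1 * a p.-1).
Proof.
move=> pm jt; apply/eqP; rewrite -subr_eq0 -rmorphM -rmorphB; apply/eqP/f0.
rewrite mem_cat; apply/orP; left; apply/allpairsP; exists (p, j).
by split=> //; rewrite mem_iota /=; lia.
Qed.

Lemma map_square (i : nat) : (i < m./2)%N ->
  f (b (lone + i.*2).+1) * f (b (lone + i.*2).+1) =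
  f (b (lone + i.*2).+2) * f (b (lone + i.*2).+2).
Proof.
move=> im; apply/eqP; rewrite -subr_eq0 -!rmorphM -rmorphB; apply/eqP/f0.
rewrite !mem_cat; apply/orP; right; apply/orP; left.
by apply/mapP; exists i; rewrite ?mem_iota.
Qed.

Lemma map_top : f (a t) * f (a t) =
  f (if odd n then a m * a m else b lone * b lone).
Proof.
apply/eqP; rewrite -subr_eq0 -rmorphM -rmorphB; apply/eqP/f0.
by rewrite !mem_cat mem_head !orbT.
Qed.

Lemma map_lone : odd n -> odd m -> f (b 1) * f (b 1) = 0.
Proof.
move=> n_odd m_odd; rewrite -rmorphM; apply: f0.
by rewrite !mem_cat n_odd m_odd !inE eqxx !orbT.
Qed.

(** For [k < t] the square of [a k] is [b k.+1 * a k.+1], except for [k = m]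
    with [n] odd, where it is the square of [a t] by the last relation. *)
Lemma generators_nilpotent : exists N, forall w : seq 'I_n,
  (N <= size w)%N -> \prod_(x <- w) f (gen x) = 0.
Proof.
pose fa i := f (a i); pose fb p := f (b p).
have fa0 : fa 0%N = 0 by rewrite /fa raddf0.
have fb0 : fb 0%N = 0 by rewrite /fb raddf0.
have mt : (m <= t)%N by lia.
have tm : (t <= m.+1)%N by lia.
have ba_lt p j : (p < j)%N -> (j <= t)%N -> (p <= m)%N ->
    fb p * fa j = fa j * fa p.
  case: p => [|p] pj jt pm; first by rewrite fa0 fb0 mul0r mulr0.
  by rewrite map_descent ?pj ?rmorphM //; lia.
have ba_gt p j : (j < p)%N -> (p <= m)%N -> fb p * fa j = fb j * fb p.
  case: j => [|j] jp pm; first by rewrite fa0 fb0 mul0r mulr0.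
  by rewrite map_descent ?[(p < _)%N]ltnNge ?(ltnW jp) ?jp ?rmorphM //; lia.
have ba_eq p : (p < m)%N -> fb p.+1 * fa p.+1 = fa p * fa p.
  by move=> pm; rewrite map_descent ?ltnn ?rmorphM //; lia.
have lm : (lone <= m)%N by case: (m) => //= k; case: (~~ _).
have partner p : (lone < p <= m)%N ->
    exists q, [/\ (q <= m)%N, q != p & fb p * fb p = fb q * fb q].
  move=> pm; pose i := (p - lone).-1./2.
  have := odd_double_half (p - lone).-1; rewrite -/i.
  have := odd_double_half m.
  case: (odd (p - lone).-1) => pE mE.
    exists (lone + i.*2).+1.
    have -> : p = (lone + i.*2).+2 by lia.
    by split; [lia|lia|rewrite [RHS]map_square //; lia].
  exists (lone + i.*2).+2.
  have -> : p = (lone + i.*2).+1 by lia.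
  by split; [lia|lia|rewrite [LHS]map_square //; lia].
have nil_lone : nil_below fb lone.+1.
  case m_odd: (odd m); last first.
    exists 1%N => -[//|i u] /andP[]; rewrite ltnS leqn0 => /eqP-> _ _.
    by rewrite word_cons fb0 mul0r.
  case n_odd: (odd n).
    apply: (nil_below_b2 _ _ fb0 2); rewrite expr2; exact: map_lone.
  have n_even : t = m by lia.
  apply: (nil_below_b2 _ _ fb0 5).
  apply: (b1_nilpotent _ m t fa) => //; first by case: (m) m_odd.
  have := map_top; rewrite n_odd m_odd n_even.
  by rewrite rmorphM => ->.
have up k : (k < t)%N -> exists y, fa k * fa k = y * fa k.+1.
  move=> kt; have [km|mk] := ltnP k m; first by exists (fb k.+1); rewrite ba_eq.
  have [kE tE n_odd] : [/\ k = m, t = m.+1 & odd n].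
    by have := odd_double_half n; split; lia.
  by exists (fa t); rewrite kE -tE [RHS]map_top n_odd rmorphM.
have top : sorted_form _ fa fb t m.+1 2 (fa t * fa t).
  rewrite [fa t * _]map_top; case: ifP => n_odd.
    exists [:: m; m], [::]; rewrite /= rmorphM !word_cons !word0 !mulr1.
    by split=> //; rewrite andbT andbb; lia.
  exists [::], [:: lone; lone]; rewrite rmorphM !word_cons !word0 mulr1 mul1r.
  by split=> //; rewrite /= andbT andbb ltnS.
have [N nilN] := nilpotent_generators _ m t fa fb fa0 fb0 mt tm
  ba_lt ba_gt ba_eq _ lm nil_lone partner up top.
exists N => w Nw; rewrite -(big_map (fun x => f (gen x)) xpredT id).
apply: nilN => [|_ /mapP[x _ ->]]; first by rewrite size_map.
have genE (k : nat) (kx : k = x :> nat) : letter k = gen x.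
  by rewrite kx /letter valK.
have [xt|tx] := ltnP x t.
  exists [:: x.+1], [::]; rewrite /= !word_cons !word0 !mulr1 /fa /= genE //.
  by rewrite ltnS xt.
exists [::], [:: (n - x)%N]; rewrite /= !word_cons !word0 !mulr1 mul1r /fb.
have xn := ltn_ord x.
have -> : b (n - x) = gen x.
  have -> : (n - x)%N = (n - x.+1).+1 by lia.
  by rewrite /right_letter genE //; lia.
by split=> //; rewrite andbT; lia.
Qed.

End Nilpotency.
End Relations.

Theorem theorem1p3 (K : fieldType) (d n : nat) (d_gt0 : (0 < d)%N)
    (n_gt0 : (0 < n)%N) (hd : (d%:R : rat) > (n ^ 2 + n)%:R / 4%:R) :
  exists rs : semigroup_relations K n d,
    finite_dimensional (quadratic_semigroup_algebra rs).
Proof.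
have [|rs sub_rs] := nilpotency_relations_of_size K n n_gt0 d.
  by move: hd; rewrite ltr_pdivrMr ?ltr0n // -natrM ltr_nat mulnC.
pose f : {lrmorphism _ -> quadratic_semigroup_algebra rs} := quot_map K n d rs.
have f0 r : r \in nilpotency_relations K n -> f r = 0.
  by move=> /sub_rs; apply: quot_map_relation.
exists rs; have [N nilN] := generators_nilpotent K n n_gt0 _ f f0.
exact: nilpotent_finite_dimensional f N (quot_map_surj _ _ _ rs) nilN.
Qed.
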